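(* Let $D$ be a weakly locally finite division ring with center $F$ and let $N$ be a subnormal subgroup of the multiplicative group $D^*$. If $N$ is radical over $F$, then $N\subseteq F$.
   Context: A division ring $D$ is weakly locally finite if for every finite subset $S\subseteq D$, the division subring generated by $S$ is finite dimensional over its own center. A subset $N$ of $D$ is radical over a subring $K$ if for each $x\in N$ there is a positive integer $n(x)$ with $x^{n(x)}\in K$. *)

(* Defs.v *)
From HB Require Import structures.
From mathcomp Require Import all_boot all_order all_algebra.
Set Implicit Arguments. Unset Strict Implicit. Unset Printing Implicit Defensive.
Import GRing.Theory.
Local Open Scope ring_scope.

Definition is_division_ring (D : unitRingType) : Prop :=
  forall x : D, x != 0 -> x \is a GRing.unit.

Definition center (D : unitRingType) (x : D) : Prop :=
  forall y : D, x * y = y * x.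

Definition is_division_subring (D : unitRingType) (T : D -> Prop) : Prop :=
  [/\ T 0, T 1,
      (forall x y, T x -> T y -> T (x - y)),
      (forall x y, T x -> T y -> T (x * y)) &
      (forall x, x != 0 -> T x -> T x^-1)].

Definition gen_division_subring (D : unitRingType) (S : D -> Prop) (x : D) : Prop :=
  forall T : D -> Prop, is_division_subring T -> (forall s, S s -> T s) -> T x.

Definition sub_center (D : unitRingType) (T : D -> Prop) (x : D) : Prop :=
  T x /\ forall y, T y -> x * y = y * x.

Definition fin_dim_over_center (D : unitRingType) (T : D -> Prop) : Prop :=
  exists b : seq D, (forall i, (i < size b)%N -> T b`_i) /\
    forall x, T x -> exists c : seq D, size c = size b /\
      (forall i, (i < size b)%N -> sub_center T c`_i) /\
      x = \sum_(i < size b) c`_i * b`_i.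

Definition weakly_locally_finite (D : unitRingType) : Prop :=
  forall S : seq D, fin_dim_over_center (gen_division_subring (fun x => x \in S)).

Definition units_set (D : unitRingType) (x : D) : Prop := x != 0.

Definition is_subgroup (D : unitRingType) (N : D -> Prop) : Prop :=
  [/\ (forall x, N x -> x != 0), N 1,
      (forall x y, N x -> N y -> N (x * y)) &
      (forall x, N x -> N x^-1)].

Definition normal_in (D : unitRingType) (N M : D -> Prop) : Prop :=
  [/\ is_subgroup N, is_subgroup M, (forall x, N x -> M x) &
      (forall x y, N x -> M y -> N (y^-1 * x * y))].

Inductive subnormal (D : unitRingType) : (D -> Prop) -> Prop :=
  | subnormal_top : subnormal (@units_set D)
  | subnormal_step (N M : D -> Prop) : subnormal M -> normal_in N M -> subnormal N.

Definition radical_over (D : unitRingType) (N K : D -> Prop) : Prop :=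
  forall x, N x -> exists n : nat, (0 < n)%N /\ K (x ^+ n).

(* Main.v *)
Require Import Defs.
From HB Require Import structures.
From mathcomp Require Import all_boot all_order all_algebra all_field.
From mathcomp Require Import boolp.
Set Implicit Arguments. Unset Strict Implicit. Unset Printing Implicit Defensive.
Import GRing.Theory.
Local Open Scope ring_scope.

(** Let a be in N and b in D. The division ring K generated by a and b has finite
    dimension over its center F. If N is subnormal of depth r, then for every
    nonzero x in K the iterated commutator w_(r+1)(x) = [a, [a, ..., [a, x]]] lies
    in N, so a power of it is central; since it has norm 1, it is torsion. The
    structure constants of K generate F as a field, and a finitely generated field
    has only finitely many roots of unity of bounded degree, so all torsion
    elements of K satisfy u ^ B = 1 for one B that is nonzero in F.

    If F is finite, Wedderburn's little theorem applies. Otherwise put x = 1 + t b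
    with t in F. Each w_i is a rational function of t with value 1 at t = 0, so
    1 + w_i + ... + w_i ^ (B - 1), which is B at t = 0, is nonzero for almost all t;
    hence w_i = 1 as soon as w_i is torsion. From w_(i+1) = 1 it follows that
    w_i = [a, w_(i-1)] commutes with a, which makes w_i torsion because a power of
    a is central. Descending to i = 0, a commutes with 1 + t b, hence with b. *)

(** * Subtypes of division subrings *)

Lemma gen_division_subringP (D : unitRingType) (S : D -> Prop) :
  is_division_subring (gen_division_subring S).
Proof.
split=> [T []|T []|x y Sx Sy T Tsub ST|x y Sx Sy T Tsub ST|x x0 Sx T Tsub ST] //.
- by have [_ _ TB _ _] := Tsub; apply: TB; [exact: Sx|exact: Sy].
- by have [_ _ _ TM _] := Tsub; apply: TM; [exact: Sx|exact: Sy].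
- by have [_ _ _ _ TV] := Tsub; apply: TV => //; exact: Sx.
Qed.

Lemma mem_gen_division_subring (D : unitRingType) (S : D -> Prop) x :
  S x -> gen_division_subring S x.
Proof. by move=> Sx T _; exact. Qed.

Section DivisionSubringType.
Variables (D : unitRingType) (T : D -> Prop) (T_sub : is_division_subring T).

(** The proof of closure is an argument of the predicate, so that the structures below can be
    inferred from the predicate itself. *)
Definition division_subring_pred (_ : is_division_subring T) : {pred D} :=
  fun x => `[< T x >].

Lemma division_subring_predP x :
  reflect (T x) (x \in division_subring_pred T_sub).
Proof. exact: asboolP. Qed.

Fact division_subring_closed : divring_closed (division_subring_pred T_sub).
Proof.
have [T0 T1 TB TM TV] := T_sub.
split=> [|x y /asboolP Tx /asboolP Ty|x y /asboolP Tx /asboolP Ty];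
  apply/asboolP; [by []|exact: TB|].
apply: TM => //; have [->|y0] := eqVneq y 0; [by rewrite invr0|exact: TV].
Qed.

HB.instance Definition _ :=
  GRing.isDivringClosed.Build D (division_subring_pred T_sub)
    division_subring_closed.

Definition division_subring_type : Type :=
  {x : D | x \in division_subring_pred T_sub}.

HB.instance Definition _ := SubType.on division_subring_type.
HB.instance Definition _ := Choice.on division_subring_type.
HB.instance Definition _ := [SubChoice_isSubUnitRing of division_subring_type by <:].

Lemma division_subring_valP (x : division_subring_type) : T (val x).
Proof. exact/division_subring_predP/valP. Qed.

Definition in_division_subring x (Tx : T x) : division_subring_type :=
  Sub x (introT (division_subring_predP x) Tx).

Lemma division_subring_div : is_division_ring D ->
  is_division_ring division_subring_type.
Proof.
move=> D_div x x0.
have vx0 : val x != 0.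
  by apply: contraNneq x0 => vx; apply/eqP/val_inj; rewrite rmorph0.
have [_ _ _ _ TV] := T_sub; have Ux := D_div _ vx0; apply/unitrP.
exists (in_division_subring (TV _ vx0 (division_subring_valP x))).
by split; apply: val_inj; rewrite rmorphM rmorph1 /= ?mulVr ?mulrV.
Qed.

Lemma division_subring_lift (s : seq D) :
  (forall x, x \in s -> T x) ->
  exists s' : seq division_subring_type, map val s' = s.
Proof.
elim: s => [|x s IHs] Ts; first by exists [::].
have [y sy|s' es'] := IHs; first by apply: Ts; rewrite inE sy orbT.
have Tx : T x by apply: Ts; rewrite mem_head.
by exists (in_division_subring Tx :: s'); rewrite /= es'.
Qed.

End DivisionSubringType.

Section SubfieldType.
Variables (D : unitRingType) (T : D -> Prop) (T_sub : is_division_subring T).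
Hypothesis D_div : is_division_ring D.
Hypothesis T_comm : forall x y, T x -> T y -> x * y = y * x.

Definition subfield_type
    (_ : is_division_ring D) (_ : forall x y, T x -> T y -> x * y = y * x) :=
  division_subring_type T_sub.

Local Notation L := (subfield_type D_div T_comm).

HB.instance Definition _ := SubType.on L.
HB.instance Definition _ := GRing.SubUnitRing.on L.

Fact subfield_mulC : @commutative L L *%R.
Proof.
by move=> x y; apply: val_inj; rewrite !rmorphM /= T_comm //;
  exact: division_subring_valP.
Qed.

HB.instance Definition _ := GRing.PzRing_hasCommutativeMul.Build L subfield_mulC.

HB.instance Definition _ := GRing.ComUnitRing_isField.Build L
  (@division_subring_div _ _ T_sub D_div).
End SubfieldType.

(** * Roots of unity of bounded degree *)

Section Fractions.
Variables (R : comNzRingType) (F : fieldType) (k : {rmorphism R -> F}).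

(** If every [x] is a fraction, then [k = intr] makes [F] a prime field, and evaluation of
    polynomials at [c] makes it the simple extension by [c]. *)
Definition is_fraction (x : F) := exists a b, k b != 0 /\ x = k a / k b.

Lemma fraction_division_subring : is_division_subring is_fraction.
Proof.
split.
- by exists 0, 1; rewrite rmorph0 rmorph1 oner_neq0 mul0r.
- by exists 1, 1; rewrite rmorph1 oner_neq0 divr1.
- move=> _ _ [a [b [b0 ->]]] [c [d [d0 ->]]].
  exists (a * d - c * b), (b * d); rewrite rmorphM mulf_neq0 //; split=> //.
  by rewrite -mulNr addf_div // rmorphB !rmorphM /= mulNr.
- move=> _ _ [a [b [b0 ->]]] [c [d [d0 ->]]].
  exists (a * c), (b * d); rewrite rmorphM mulf_neq0 //; split=> //.
  by rewrite mulf_div !rmorphM.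
- move=> x x0 [a [b [b0 e]]]; rewrite {}e in x0 *.
  have a0 : k a != 0 by apply: contraNneq x0 => ->; rewrite mul0r.
  by exists b, a; rewrite invf_div.
Qed.

Lemma clear_denominators (p : {poly F}) : (forall x, is_fraction x) ->
  exists b (q : {poly R}),
    [/\ k b != 0, (size q <= size p)%N & map_poly k q = k b *: p].
Proof.
move=> frac.
have /choice[nd ndP] x : exists ab : R * R, k ab.2 != 0 /\ x = k ab.1 / k ab.2.
  by have [a [b ?]] := frac x; exists (a, b).
pose n := size p; pose den i := (nd p`_i).2.
exists (\prod_(i < n) den i),
  (\poly_(i < n) ((nd p`_i).1 * \prod_(j < n | j != i :> nat) den j)).
have P0 (P : pred 'I_n) : k (\prod_(i < n | P i) den i) != 0.
  by rewrite rmorph_prod; apply/prodf_neq0 => i _; case: (ndP p`_i).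
split; [exact: P0|exact: size_poly|].
apply/polyP=> i; rewrite coef_map /= coefZ coef_poly.
case: ltnP => [lt_in|le_ni]; last first.
  rewrite (nth_default _ le_ni) mulr0; exact: rmorph0.
have [d0 e] := ndP p`_i.
rewrite [X in _ = k X * _](bigD1 (Ordinal lt_in)) //= !rmorphM /=.
rewrite [X in _ = _ * X]e [k (den i) * _]mulrC -mulrA [k (den i) * _]mulrC divfK //.
by rewrite mulrC; congr (k _ * _); apply: eq_bigl => j.
Qed.
End Fractions.

(** As ['X^n - 1] is the product of the ['Phi_d] with [d] dividing [n], some ['Phi_d] vanishes at
    [z]. Then [z ^+ d = 1], so [n] divides [d] and both are equal. *)
Lemma root_Cyclotomic_prim (E : fieldType) (z : E) n :
  n.-primitive_root z -> root (map_poly intr 'Phi_n) z.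
Proof.
move=> prim_z; have n0 := prim_order_gt0 prim_z.
have : (map_poly (intr : int -> E) (\prod_(d <- divisors n) 'Phi_d)).[z] = 0.
  rewrite prod_Cyclotomic // rmorphB rmorph1 /= map_polyXn !hornerE.
  by rewrite prim_expr_order // subrr.
rewrite rmorph_prod horner_prod /= => /eqP.
rewrite big_seq prodf_seq_eq0 => /hasP[d d_n /andP[_ Phi_dz]].
suff -> : n = d by [].
have d0 : (0 < d)%N by move: d_n; rewrite -dvdn_divisors // => /dvdn_gt0->.
apply/eqP; rewrite eqn_dvd [X in _ && X]dvdn_divisors // d_n andbT.
rewrite (prim_order_dvd prim_z) -subr_eq0.
have := congr1 (fun p : {poly int} => (map_poly (intr : int -> E) p).[z])
  (prod_Cyclotomic d0).
rewrite (bigD1_seq d) ?divisors_uniq ?divisors_id //= rmorphM hornerM /=.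
rewrite (eqP Phi_dz) mul0r rmorphB rmorph1 /= map_polyXn !hornerE.
by move/esym/eqP.
Qed.

(* A common complex root of q and Phi_n makes Phi_n divide q over the rationals;
   otherwise their resultant is a nonzero integer vanishing in E. *)
Lemma totient_lt_size (E : fieldType) (z : E) n (q : {poly int}) :
  (forall m : int, m != 0 -> m%:~R != 0 :> E) ->
  n.-primitive_root z -> q != 0 -> root (map_poly intr q) z ->
  (totient n < size q)%N.
Proof.
move=> char0 prim_z q0 qz; have Phiz := root_Cyclotomic_prim prim_z.
have szq : (1 < size q)%N.
  rewrite ltnNge; apply/negP=> szq; move: qz q0.
  rewrite (size1_polyC szq) map_polyC /= rootC polyC_eq0 => q0 /char0.
  by rewrite q0.
have szPhi : (1 < size 'Phi_n)%N.
  by rewrite size_Cyclotomic ltnS totient_gt0 (prim_order_gt0 prim_z).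
rewrite -ltnS -size_Cyclotomic ltnS.
have [res0|res0] := eqVneq (resultant q 'Phi_n) 0; last first.
  have [[u v] /= _ e] := resultant_in_ideal szq szPhi.
  have := congr1 (fun p : {poly int} => (map_poly (intr : int -> E) p).[z]) e.
  rewrite map_polyC /= hornerC rmorphD !rmorphM /= hornerD !hornerM.
  rewrite (eqP qz) (eqP Phiz) !mulr0 addr0 => /eqP.
  by rewrite (negPf (char0 _ res0)).
have intrC_inj : injective (intr : int -> algC) := @intr_inj algC.
have [w qw Phiw] : exists2 w : algC,
    root (map_poly intr q) w & root (map_poly intr 'Phi_n) w.
  move/eqP: res0; rewrite resultant_eq0 => sz_gcd.
  pose g := gcdp q 'Phi_n.
  have dvd_root (r : {poly int}) w : g %| r ->
      root (map_poly (intr : int -> algC) g) w -> root (map_poly intr r) w.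
    case/Pdiv.Idomain.dvdpP=> -[m s] /= m0 e gw.
    have := congr1 (fun s : {poly int} => (map_poly (intr : int -> algC) s).[w]) e.
    rewrite map_polyZ rmorphM /= hornerZ hornerM (eqP gw) mulr0 => /eqP.
    by rewrite mulf_eq0 intr_eq0 (negPf m0).
  have /closed_rootP[w gw] : size (map_poly (intr : int -> algC) g) != 1%N.
    by rewrite (size_map_inj_poly intrC_inj) // neq_ltn sz_gcd orbT.
  by exists w; apply: dvd_root gw;
    rewrite ?Pdiv.Idomain.dvdp_gcdl ?Pdiv.Idomain.dvdp_gcdr.
have [w0 prim_w0] := C_prim_root_exists (prim_order_gt0 prim_z).
have prim_w : n.-primitive_root w.
  by move: Phiw; rewrite (Cintr_Cyclotomic prim_w0) root_cyclotomic.
(* The minimal polynomial of [w] over the rationals is ['Phi_n], so it divides [q]. *)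
have [p [Dp _] dv_p] := minCpolyP w.
have := minCpoly_cyclotomic prim_w.
rewrite Dp -(Cintr_Cyclotomic prim_w) => /(congr1 (size : {poly algC} -> nat)).
rewrite size_map_poly (size_map_inj_poly intrC_inj) // => <-.
rewrite -(size_map_inj_poly (@intr_inj rat) (rmorph0 _) q).
apply: dvdp_leq.
  by rewrite -size_poly_gt0 size_map_inj_poly ?size_poly_gt0 //; exact: intr_inj.
rewrite -dv_p -map_poly_comp; congr (root _ w): qw.
by apply: eq_map_poly => b; rewrite /= rmorph_int.
Qed.

(** If [p ^ k] exactly divides [n], then [totient n] is at least [(p - 1) * p ^ (k - 1)]. Since
    [p <= 2 * (p - 1)], this gives [p ^ k <= 2 * d], so each primary part of [n] divides the
    factorial. *)
Lemma dvdn_fact_totient n d :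
  (0 < n)%N -> (totient n <= d)%N -> (n %| (d.*2)`!)%N.
Proof.
move=> n0 le_nd; apply/dvdn_partP => // p p_n; apply: dvdn_fact.
rewrite part_gt0 p_part /=.
apply: leq_trans (_ : (totient n).*2 <= _)%N; last by rewrite leq_double.
have p_pr : prime p by move: p_n; rewrite mem_primes => /andP[].
have k0 : (0 < logn p n)%N by rewrite logn_gt0.
rewrite totientE // (bigD1_seq p) ?primes_uniq //=.
rewrite -[in X in (X <= _)%N](prednK k0) expnS.
have rest0 : (0 < \prod_(q <- primes n | q != p) (q.-1 * q ^ (logn q n).-1))%N.
  rewrite big_seq_cond prodn_cond_gt0 // => q /andP[].
  by rewrite mem_primes muln_gt0 expn_gt0; case: q => [|[|]].
rewrite doubleMl; apply: leq_trans (leq_pmulr _ rest0).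
rewrite doubleMl leq_mul2r; apply/orP; right.
by case: (p) (prime_gt1 p_pr) => [|[|q]] // _;
  rewrite succnK doubleS !ltnS -addnn leq_addr.
Qed.
(** The family [v] is a nonzero eigenvector for [z] of the image of [A] under [f]. *)
Lemma root_char_family (F E : fieldType) (f : {rmorphism F -> E}) (I : finType)
    (v : I -> E) (A : I -> I -> F) (z : E) (i0 : I) :
  v i0 != 0 -> (forall i, z * v i = \sum_j f (A i j) * v j) ->
  exists p : {poly F}, [/\ p != 0, size p = #|I|.+1 & root (map_poly f p) z].
Proof.
(* The indices of [A] are swapped because eigenvectors are row vectors. *)
move=> v0 zv; pose M := \matrix_(i, j < #|I|) A (enum_val j) (enum_val i).
exists (char_poly M); split; first exact/monic_neq0/char_poly_monic.
  exact: size_char_poly.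
rewrite map_char_poly -eigenvalue_root_char; apply/eigenvalueP.
exists (\row_j v (enum_val j)); last first.
  apply: contraNneq v0 => /rowP/(_ (enum_rank i0)).
  by rewrite !mxE enum_rankK => ->.
apply/rowP=> j; rewrite !mxE zv (reindex (@enum_val I I)) /=; last first.
  by apply: onW_bij; exact: enum_val_bij.
by apply: eq_bigr => i _; rewrite !mxE mulrC.
Qed.

(** [B] depends on [d] alone and serves all extensions [E] at once; this uniformity lets the
    property pass from a field to a simple extension. *)
Definition bounded_roots_of_unity (F : fieldType) : Prop :=
  forall d : nat, exists B : nat, forall (E : fieldType) (f : {rmorphism F -> E})
    (z : E) (n : nat) (p : {poly F}),
  p != 0 -> (size p <= d)%N -> root (map_poly f p) z -> n.-primitive_root z ->
  (n <= B)%N.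

Section PrimeField.
Variable F : fieldType.
Hypothesis frac : forall x : F, is_fraction (intr : {rmorphism int -> F}) x.

Lemma bounded_roots_of_unity_pchar0 :
  (forall m : int, m != 0 -> m%:~R != 0 :> F) -> bounded_roots_of_unity F.
Proof.
move=> char0 d; exists ((d.*2)`!) => E f z n p p0 szp pz prim_z.
have [b [q [b0 szq eq_q]]] := clear_denominators p frac.
have n0 := prim_order_gt0 prim_z.
have q0 : q != 0.
  apply: contraNneq p0 => q0; move/eqP: eq_q; rewrite q0 rmorph0 eq_sym.
  by rewrite scaler_eq0 (negPf b0).
have qz : root (map_poly intr q) z.
  have -> : map_poly (intr : int -> E) q = map_poly f (map_poly intr q).
    by rewrite -map_poly_comp; apply: eq_map_poly => m; rewrite /= rmorph_int.
  by rewrite eq_q map_polyZ rootE hornerZ (eqP pz) mulr0.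
have charE m : m != 0 -> m%:~R != 0 :> E.
  by move=> /char0; rewrite -(fmorph_eq0 f) rmorph_int.
have lt_n := totient_lt_size charE prim_z q0 qz.
apply: dvdn_leq; first exact: fact_gt0.
apply: dvdn_fact_totient => //.
exact: leq_trans (ltnW lt_n) (leq_trans szq szp).
Qed.

Lemma prime_field_nat (p : nat) (x : F) : p \in [pchar F] -> exists n, x = n%:R.
Proof.
move=> charF; have p_pr := pcharf_prime charF.
have intP (m : int) : exists n, m%:~R = n%:R :> F.
  case: m => n; first by exists n.
  exists (p.-1 * n.+1)%N; rewrite NegzE rmorphN /=.
  apply/eqP; rewrite eq_sym -addr_eq0 -natrD -mulSnr prednK ?prime_gt0 //.
  by rewrite natrM (pcharf0 charF) mul0r.
have [a [b [b0 ->]]] := frac x.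
have [m em] := intP a; have [n en] := intP b; rewrite /= in b0.
(* By Fermat's little theorem [n ^ p.-2] represents the inverse of [n]. *)
exists (m * n ^ p.-2)%N; rewrite /= em en natrM natrX; congr (_ * _).
rewrite en in b0; apply: (mulfI b0); rewrite mulfV // -exprS.
have -> : (p.-2).+1 = p.-1 by case: (p) p_pr => [|[|]].
apply: (mulfI b0); rewrite mulr1 -exprS prednK ?prime_gt0 //.
by rewrite -(pFrobenius_autE charF) pFrobenius_aut_nat.
Qed.

(** The [n] distinct powers of [z] are determined by the remainders of ['X^i] modulo [q], which have
    at most [d] coefficients in a field of [p] elements. *)
Lemma bounded_roots_of_unity_pchar (p : nat) :
  p \in [pchar F] -> bounded_roots_of_unity F.
Proof.
move=> charF d; exists (p ^ d)%N => E f z n q q0 szq qz prim_z.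
have p0 : (0 < p)%N by exact/prime_gt0/(pcharf_prime charF).
have /choice[h hP] x : exists m, x = m%:R := prime_field_nat x charF.
pose r i : {poly F} := 'X^i %% q.
have rz i : (map_poly f (r i)).[z] = z ^+ i.
  have := congr1 (fun s => (map_poly f s).[z]) (divp_eq 'X^i q).
  rewrite /= map_polyXn hornerXn rmorphD rmorphM /= hornerD hornerM (eqP qz).
  by rewrite mulr0 add0r.
have sz_r i : (size (r i) <= d)%N.
  by apply: leq_trans szq; apply: ltnW; rewrite ltn_modp.
pose g (i : 'I_n) := [ffun j : 'I_d => Ordinal (ltn_pmod (h (r i)`_j) p0)].
have g_inj : injective g.
  move=> i j /ffunP eq_g; have eq_r : r i = r j.
    apply/polyP=> l; have [lt_ld|le_dl] := ltnP l d; last first.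
      by rewrite !nth_default // (leq_trans (sz_r _)).
    have /(congr1 val) := eq_g (Ordinal lt_ld); rewrite !ffunE /= => eq_h.
    rewrite (hP (r i)`_l) (hP (r j)`_l).
    by rewrite -[LHS](GRing.natr_mod_pchar charF) eq_h GRing.natr_mod_pchar.
  have := rz i; rewrite eq_r rz => /eqP.
  rewrite (eq_prim_root_expr prim_z) !modn_small // => /eqP e.
  exact/val_inj.
by have := leq_card g g_inj; rewrite card_ord card_ffun !card_ord.
Qed.

Lemma bounded_roots_of_unity_prime : bounded_roots_of_unity F.
Proof.
have [char0|] := pselect (forall m : int, m != 0 -> m%:~R != 0 :> F).
  exact: bounded_roots_of_unity_pchar0.
move=> /existsNP[m /not_implyP[m0 /negP/negPn/eqP mF0]].
have mF : (`|m|%N)%:R = 0 :> F.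
  case: (m) mF0 => k //; rewrite NegzE rmorphN /= => /eqP.
  by rewrite oppr_eq0 => /eqP.
have [p charF] : exists p, p \in [pchar F].
  have : (0 < `|m|)%N by rewrite absz_gt0.
  move: (`|m|%N) mF => k kF k0.
  by have /natf0_pchar := k0; move/(_ F (introT eqP kF)).
exact: bounded_roots_of_unity_pchar charF.
Qed.
End PrimeField.

(** * Passage to a simple extension *)

Section SimpleExtension.
Variables (F F' : fieldType) (k : {rmorphism F -> F'}) (c : F').
Let ev : {rmorphism {poly F} -> F'} := horner_eval c \o map_poly k.

Lemma fraction_adjoined : is_fraction ev c.
Proof.
exists 'X, 1; rewrite rmorph1 oner_neq0 divr1; split=> //.
by rewrite /ev /= map_polyX /horner_eval hornerX.
Qed.

Lemma fraction_base x : is_fraction ev (k x).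
Proof.
exists x%:P, 1; rewrite rmorph1 oner_neq0 divr1; split=> //.
by rewrite /ev /= map_polyC /horner_eval hornerC.
Qed.

Hypothesis frac : forall x : F', is_fraction ev x.
Hypothesis boundF : bounded_roots_of_unity F.

(** [g] may be reducible: [gdcop b g] is coprime to [b] and keeps the root [c], because [b] does not
    vanish there. A Bezout relation then inverts the value of [b] at [c], and reduction modulo [g]
    bounds the size. *)
Lemma algebraic_fraction_poly (g : {poly F}) (x : F') :
  g != 0 -> root (map_poly k g) c ->
  exists h : {poly F}, (size h < size g)%N /\ x = (map_poly k h).[c].
Proof.
move=> g0 gc; have [a [b [b0 ->]]] := frac x.
have g1c : root (map_poly k (gdcop b g)) c.
  by rewrite gdcop_map root_gdco ?map_poly_eq0 // gc.
have /Bezout_eq1_coprimepP[[u1 u2] /= e] := coprimep_gdco b g0.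
have evg1 : ev (gdcop b g) = 0 := eqP g1c.
have evg : ev g = 0 := eqP gc.
have inv_b : ev u2 * ev b = 1.
  have := congr1 ev e; rewrite rmorphD [ev (u1 * _)]rmorphM [ev (u2 * _)]rmorphM.
  by rewrite rmorph1 evg1 mulr0 add0r.
exists ((a * u2) %% g); split; first by rewrite ltn_modp.
have -> : (map_poly k ((a * u2) %% g)).[c] = ev a * ev u2.
  have := congr1 ev (divp_eq (a * u2) g).
  rewrite rmorphD [ev (a * u2)]rmorphM [ev (_ * g)]rmorphM evg mulr0 add0r.
  exact: esym.
by apply: (mulIf b0); rewrite divfK // -mulrA inv_b mulr1.
Qed.

(* The products [c ^+ i * z ^+ j] span a space stable under multiplication by [z],
   so [z] is a root of a characteristic polynomial. *)
Lemma bounded_roots_of_unity_algebraic (g : {poly F}) :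
  g != 0 -> root (map_poly k g) c -> bounded_roots_of_unity F'.
Proof.
(* There are at most [size g * d] products, and a characteristic polynomial has one more coefficient
   than its degree. *)
move=> g0 gc d; have [B BP] := boundF (size g * d).+1.
exists B => E f z n p p0 szp pz prim_z.
have size_gt1 (K K' : fieldType) (t : {rmorphism K -> K'}) (r : {poly K}) y :
    r != 0 -> root (map_poly t r) y -> (0 < (size r).-1)%N.
  move=> r0 ry; rewrite -ltnS prednK ?size_poly_gt0 //.
  by rewrite -(size_map_poly t); apply: root_size_gt1 ry; rewrite map_poly_eq0.
have k0 := size_gt1 _ _ _ _ _ g0 gc; have m0 := size_gt1 _ _ _ _ _ p0 pz.
pose m := (size p).-1; pose l := (size g).-1.
pose I := ('I_l * 'I_m)%type; pose v (i : I) := f c ^+ i.1 * z ^+ i.2.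
have spanP (x : 'I_m -> F') : exists a : I -> F,
    \sum_j f (x j) * z ^+ j = \sum_i f (k (a i)) * v i.
  have /choice[h hP] j : exists h : {poly F},
      (size h < size g)%N /\ x j = (map_poly k h).[c].
    exact: algebraic_fraction_poly.
  exists (fun i : I => (h i.2)`_(i.1)).
  rewrite -(pair_bigA _ (fun (i : 'I_l) (j : 'I_m) =>
    f (k (h j)`_i) * v (i, j))) exchange_big /=.
  apply: eq_bigr => j _; have [szh ->] := hP j.
  rewrite (@horner_coef_wide _ l); last first.
    by rewrite size_map_poly -ltnS prednK ?size_poly_gt0.
  rewrite rmorph_sum mulr_suml; apply: eq_bigr => i _.
  by rewrite coef_map rmorphM rmorphXn /= mulrA.
have /choice[A AP] (i : I) : exists a : I -> F,
    z * v i = \sum_j (f \o k) (a j) * v j.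
  pose r := 'X^(i.2.+1) %% p.
  have [a aP] := spanP (fun j => c ^+ i.1 * r`_j); exists a; rewrite -aP.
  have -> : z * v i = f c ^+ i.1 * (map_poly f r).[z].
    rewrite /v mulrCA -exprS; congr (_ * _).
    have := congr1 (fun s => (map_poly f s).[z]) (divp_eq 'X^(i.2.+1) p).
    rewrite /= map_polyXn hornerXn rmorphD rmorphM /= hornerD hornerM (eqP pz).
    by rewrite mulr0 add0r.
  rewrite (@horner_coef_wide _ m); last first.
    by rewrite size_map_poly -ltnS prednK ?size_poly_gt0 // ltn_modp.
  rewrite mulr_sumr; apply: eq_bigr => j _.
  by rewrite coef_map rmorphM rmorphXn mulrA.
pose i0 : I := (Ordinal k0, Ordinal m0).
have v0 : v i0 != 0 by rewrite /v !expr0 mulr1 oner_neq0.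
have [q [q0 szq qz]] := root_char_family v0 AP.
apply: (BP E (f \o k) z n q) => //.
rewrite szq ltnS card_prod !card_ord; apply: leq_mul; first exact: leq_pred.
by apply: leq_trans szp; exact: leq_pred.
Qed.

(* If [c] is transcendental it stays so over the algebraic element [z], so a relation
   for [z] over [F(c)] splits into relations over [F]. *)
Lemma bounded_roots_of_unity_transcendental :
  (forall g : {poly F}, root (map_poly k g) c -> g = 0) ->
  bounded_roots_of_unity F'.
Proof.
move=> trc d; have [B BP] := boundF d.
exists B => E f z n p p0 szp pz prim_z.
have [b [q [b0 szq eq_q]]] := clear_denominators p frac.
have q0 : q != 0.
  apply: contraNneq p0 => q0; move/eqP: eq_q; rewrite q0 rmorph0 eq_sym.
  by rewrite scaler_eq0 (negPf b0).
pose fk : {rmorphism F -> E} := f \o k.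
pose qE := map_poly (map_poly fk) q.
have qE0 : qE.[z, f c] = 0.
  have e : map_poly (horner_eval (f c)) qE = map_poly f (map_poly ev q).
    rewrite -!map_poly_comp; apply: eq_map_poly => r /=.
    by rewrite /horner_eval map_poly_comp horner_map.
  have -> : qE.[z, f c] = (map_poly (horner_eval (f c)) qE).[z].
    rewrite -[qE.[_, _]]/(horner_eval (f c) _) -horner_map /=.
    by rewrite /horner_eval hornerC.
  by rewrite e eq_q map_polyZ hornerZ (eqP pz) mulr0.
(* In [q] the outer variable stands for [z] and the inner one for [c]. After the swap, [W] is a
   polynomial with coefficients in [F[z]] and root [f c]. *)
pose Q := swapXY q.
pose evz : {rmorphism {poly F} -> E} := horner_eval z \o map_poly fk.
pose W := map_poly evz Q.
have Wc : root W (f c).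
  apply/rootP; rewrite -qE0 -horner2_swapXY swapXY_map.
  rewrite -[RHS]/(horner_eval z _) -horner_map /= [horner_eval z _%:P]hornerC.
  by rewrite -map_poly_comp.
(* If [W] is zero, all coefficients of [Q] vanish at [z], and the leading one is a nonzero relation
   for [z] over [F]. *)
have [W0|W0] := eqVneq W 0.
  have : Q != 0 by rewrite swapXY_eq0.
  rewrite -lead_coef_eq0; set r := lead_coef Q => r0.
  apply: (BP E fk z n r) => //.
    apply: leq_trans szp; apply: leq_trans szq.
    by apply: leq_trans (max_size_coefXY Q _) _; rewrite sizeYE swapXYK.
  by apply/rootP; have /polyP/(_ (size Q).-1) := W0; rewrite coef0 coef_map.
(* If [W] is nonzero, [f c] is algebraic over [F[z]]; as [z] is integral over [F], so is [f c],
   against transcendence. *)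
have z_int : integralOver fk z.
  exists ('X^n - 1); first by rewrite monicXnsubC ?(prim_order_gt0 prim_z).
  rewrite rootE rmorphB rmorph1 /= map_polyXn !hornerE.
  by rewrite (prim_expr_order prim_z) subrr.
have [g g_monic gc] : integralOver fk (f c).
  apply: integral_root W0 Wc _ => _ /(nthP 0)[i _ <-].
  rewrite coef_map; apply: integral_horner z_int => _ /(nthP 0)[j _ <-].
  by rewrite coef_map; exact: integral_id.
have /trc g0 : root (map_poly k g) c.
  by move: gc; rewrite map_poly_comp fmorph_root.
by rewrite g0 monicE lead_coef0 eq_sym oner_eq0 in g_monic.
Qed.

Lemma bounded_roots_of_unity_simple : bounded_roots_of_unity F'.
Proof.
have [[g [g0 gc]]|trc] :=
  pselect (exists g : {poly F}, g != 0 /\ root (map_poly k g) c).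
  exact: bounded_roots_of_unity_algebraic gc.
apply: bounded_roots_of_unity_transcendental => g gc.
by apply/eqP/negPn/negP => g0; apply: trc; exists g.
Qed.
End SimpleExtension.

(** * Combinations and the regular representation *)

(** The image in [D] of a division subring of the subtype that contains [s] is a division subring
    [V] containing the generators of [T]. *)
Lemma gen_division_subring_lift (D : unitRingType) (T : D -> Prop)
    (T_sub : is_division_subring T) (s : seq (division_subring_type T_sub)) :
  is_division_ring D ->
  (forall x, T x -> gen_division_subring (fun y => y \in map val s) x) ->
  forall y, gen_division_subring (fun z => z \in s) y.
Proof.
move=> D_div T_gen y U [U0 U1 UB UM UV] sU.
have L_div := @division_subring_div _ _ T_sub D_div.
pose V x := exists2 z, U z & val z = x.
suff [z Uz /val_inj <-] : V (val y) by [].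
apply: (T_gen _ (division_subring_valP y)); last first.
  by move=> _ /mapP[z sz ->]; exists z => //; exact: sU.
split.
- by exists 0; rewrite ?rmorph0.
- by exists 1; rewrite ?rmorph1.
- by move=> _ _ [x Ux <-] [z Uz <-]; exists (x - z); [exact: UB|rewrite rmorphB].
- by move=> _ _ [x Ux <-] [z Uz <-]; exists (x * z); [exact: UM|rewrite rmorphM].
- move=> x x0 [z Uz zx]; rewrite -{}zx in x0 *.
  have z0 : z != 0 by apply: contraNneq x0 => ->; rewrite rmorph0.
  by exists z^-1; [exact: UV|rewrite rmorphV ?L_div].
Qed.

Lemma field_division_ring (F : fieldType) : is_division_ring F.
Proof. by move=> x; rewrite unitfE. Qed.

(** Induction on the number of generators: with none the field is prime, and otherwise it is a
    simple extension by [c] of the subfield generated by the others. *)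
Lemma bounded_roots_of_unity_fg n (F : fieldType) (s : seq F) :
  size s = n -> (forall x : F, gen_division_subring (fun y => y \in s) x) ->
  bounded_roots_of_unity F.
Proof.
elim: n F s => [|n IHn] F [|c s] //= sz_s Fgen.
  apply: bounded_roots_of_unity_prime => x; apply: Fgen => //.
  exact: fraction_division_subring.
case: sz_s => sz_s.
pose F1 := subfield_type (gen_division_subringP (fun y => y \in s))
  (@field_division_ring F) (fun x y _ _ => mulrC x y).
have [s1 es1] : exists s1 : seq F1, map val s1 = s.
  apply: division_subring_lift => x.
  exact: (@mem_gen_division_subring F (fun y => y \in s)).
apply: (@bounded_roots_of_unity_simple F1 F val c); last first.
  apply: (IHn F1 s1); first by rewrite -(size_map val) es1.
  apply: gen_division_subring_lift; first exact: field_division_ring.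
  by rewrite es1.
move=> x; apply: Fgen; first exact: fraction_division_subring.
move=> y; rewrite inE => /predU1P[->|sy]; first exact: fraction_adjoined.
have /mapP[z _ ->] : y \in map val s1 by rewrite es1.
exact: fraction_base.
Qed.

Section Combinations.
Variables (D : unitRingType) (L : fieldType) (iota : {rmorphism L -> D}).
Variables (n : nat) (b : 'I_n -> D).
Hypothesis iota_central : forall l x, iota l * x = x * iota l.

Definition comb (u : 'rV[L]_n) : D := \sum_i iota (u 0 i) * b i.

Hypothesis comb_eq0 : forall u, comb u = 0 -> u = 0.

Fact comb_is_zmod_morphism : zmod_morphism comb.
Proof.
move=> u v; rewrite /comb -sumrB; apply: eq_bigr => i _.
by rewrite !mxE rmorphB mulrBl.
Qed.

HB.instance Definition _ :=
  GRing.isZmodMorphism.Build 'rV[L]_n D comb comb_is_zmod_morphism.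

Lemma combZ l u : comb (l *: u) = iota l * comb u.
Proof.
rewrite /comb mulr_sumr; apply: eq_bigr => i _.
by rewrite !mxE rmorphM mulrA.
Qed.

Lemma comb_inj : injective comb.
Proof.
move=> u v /eqP; rewrite -subr_eq0 -raddfB => /eqP/comb_eq0/eqP.
by rewrite subr_eq0 => /eqP.
Qed.

Lemma mul_comb x : (forall i, exists u, x * b i = comb u) ->
  exists A : 'M[L]_n, forall u, x * comb u = comb (u *m A).
Proof.
move=> /choice[A AP]; exists (\matrix_i A i) => u.
rewrite mulmx_sum_row raddf_sum mulr_sumr; apply: eq_bigr => i _.
by rewrite rowK /= combZ mulrA -iota_central -mulrA AP.
Qed.

(** Multiplication by a nonzero [x] is injective, hence so is the matrix [A] on a finite-dimensional
    space. *)
Lemma mul_comb_unitmx x (A : 'M[L]_n) : is_division_ring D -> x != 0 ->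
  (forall u, x * comb u = comb (u *m A)) -> A \in unitmx.
Proof.
move=> D_div x0 xA; rewrite -row_free_unit; apply/row_freeP.
suff /row_freeP[B AB] : row_free A by exists B.
apply/inj_row_free => u uA; apply: comb_eq0.
by apply: (mulrI (D_div _ x0)); rewrite xA uA raddf0 mulr0.
Qed.
End Combinations.

Lemma comb_onto_gt0 (D : unitRingType) (L : fieldType) (iota : {rmorphism L -> D})
    n (b : 'I_n -> D) :
  (forall x, exists u, x = comb iota b u) -> (0 < n)%N.
Proof.
case: n b => // b /(_ 1)[u /eqP].
by rewrite /comb big_ord0 oner_eq0.
Qed.

Section RegularRepresentation.
Variables (D : unitRingType) (L : fieldType) (iota : {rmorphism L -> D}).
Variables (n' : nat).
Local Notation n := n'.+1.
Variable b : 'I_n -> D.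
Hypothesis D_div : is_division_ring D.
Hypothesis iota_central : forall l x, iota l * x = x * iota l.
Hypothesis comb_eq0 : forall u, comb iota b u = 0 -> u = 0.
Hypothesis comb_onto : forall x, exists u, x = comb iota b u.

Lemma regular_rep_exists : exists rho : D -> 'M[L]_n,
  forall x u, x * comb iota b u = comb iota b (u *m rho x).
Proof.
suff /choice[rho rhoP] x : exists A : 'M[L]_n,
   forall u, x * comb iota b u = comb iota b (u *m A).
  by exists rho.
by apply: mul_comb => // i; exact: comb_onto.
Qed.

Lemma mulmx_comb_inj (A B : 'M[L]_n) :
  (forall u, comb iota b (u *m A) = comb iota b (u *m B)) -> A = B.
Proof.
move=> eqAB; apply/row_matrixP=> i; rewrite !rowE.
exact: (comb_inj comb_eq0).
Qed.

Variable rho : D -> 'M[L]_n.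
Hypothesis rhoP : forall x u, x * comb iota b u = comb iota b (u *m rho x).

(** Left multiplication is written as a matrix acting on rows from the right, so the order is
    reversed. *)
Lemma regular_repM x y : rho (x * y) = rho y *m rho x.
Proof. by apply: mulmx_comb_inj => u; rewrite mulmxA -!rhoP mulrA. Qed.

Lemma regular_rep_scalar l : rho (iota l) = l%:M.
Proof. by apply: mulmx_comb_inj => u; rewrite -rhoP mul_mx_scalar combZ. Qed.

Lemma regular_rep1 : rho 1 = 1%:M.
Proof. by rewrite -(rmorph1 iota) regular_rep_scalar. Qed.

Lemma det_regular_repX x m : \det (rho (x ^+ m)) = \det (rho x) ^+ m.
Proof.
elim: m => [|m IHm]; first by rewrite !expr0 regular_rep1 det1.
by rewrite !exprS regular_repM det_mulmx IHm mulrC.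
Qed.

(** The determinant of [rho] is a norm with values in a commutative field, so it is trivial on
    commutators. *)
Lemma det_regular_rep_comm a x : a != 0 -> x != 0 ->
  \det (rho (a * x * a^-1 * x^-1)) = 1.
Proof.
move=> a0 x0; rewrite !regular_repM !det_mulmx.
have inv y : y != 0 -> \det (rho y^-1) * \det (rho y) = 1.
  by move=> y0; rewrite -det_mulmx -regular_repM mulrV ?D_div // regular_rep1 det1.
rewrite [\det (rho x) * \det (rho a)]mulrC [\det (rho a^-1) * _]mulrA inv //.
by rewrite mul1r inv.
Qed.

(* The commutator has norm 1, so its central power [z] satisfies [z ^+ n = 1]. *)
Lemma radical_comm_torsion a x m z : a != 0 -> x != 0 ->
  (a * x * a^-1 * x^-1) ^+ m = iota z -> (a * x * a^-1 * x^-1) ^+ (m * n) = 1.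
Proof.
move=> a0 x0 e; have := det_regular_repX (a * x * a^-1 * x^-1) m.
rewrite det_regular_rep_comm // expr1n e regular_rep_scalar det_scalar => zn.
by rewrite exprM e -rmorphXn /= zn rmorph1.
Qed.

(** Cayley-Hamilton for [rho x], applied to the coordinate vector of [1]. *)
Lemma regular_rep_char_poly x :
  \sum_(i < n.+1) iota (char_poly (rho x))`_i * x ^+ i = 0.
Proof.
have [u u1] := comb_onto 1; set p := char_poly (rho x).
have xX i : x ^+ i = comb iota b (u *m (rho x ^+ i)).
  elim: i => [|i IHi]; first by rewrite mulmx1.
  by rewrite exprS IHi rhoP -mulmxA exprSr.
have := Cayley_Hamilton (rho x); rewrite -/p /horner_mx /horner_morph.
rewrite (@horner_coef_wide _ n.+1); last first.
  by rewrite (leq_trans (size_poly _ _)) // size_char_poly.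
move=> pA; suff -> : \sum_(i < n.+1) iota p`_i * x ^+ i = comb iota b (u *m 0).
  by rewrite mulmx0 raddf0.
rewrite -pA mulmx_sumr raddf_sum; apply: eq_bigr => i _.
by rewrite coef_map /= xX -combZ -mulmxE mul_scalar_mx -scalemxAr.
Qed.
End RegularRepresentation.

(** * The center of a finite-dimensional division ring *)

Lemma center_division_subring (D : unitRingType) : is_division_subring (@center D).
Proof.
split=> [y|y|x y xZ yZ z|x y xZ yZ z|x _ xZ y].
- by rewrite mul0r mulr0.
- by rewrite mul1r mulr1.
- by rewrite mulrBl mulrBr xZ yZ.
- by rewrite -mulrA yZ mulrA xZ mulrA.
- exact/esym/commrV/esym/xZ.
Qed.

Section CenterField.
Variables (D : unitRingType) (D_div : is_division_ring D).

Lemma center_comm (x y : D) : center x -> center y -> x * y = y * x.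
Proof. by move=> xZ _; exact: xZ. Qed.

Definition center_field :=
  subfield_type (@center_division_subring D) D_div center_comm.

HB.instance Definition _ := GRing.Field.on center_field.

Local Notation F := center_field.
Local Notation iota := (val : {rmorphism F -> D}).

Lemma center_field_central (l : F) x : iota l * x = x * iota l.
Proof. exact: (division_subring_valP l). Qed.

Lemma center_basis_exists (s : seq D) :
  (forall x, exists c : seq D, [/\ size c = size s,
     (forall i, (i < size s)%N -> center c`_i) &
     x = \sum_(i < size s) c`_i * s`_i]) ->
  exists n (b : 'I_n.+1 -> D),
    (forall u, comb iota b u = 0 -> u = 0) /\
    (forall x, exists u, x = comb iota b u).
Proof.
move=> span_s.
pose spans n := exists b : 'I_n -> D, forall x, exists u, x = comb iota b u.
have exn : exists n, `[< spans n >].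
  exists (size s); apply/asboolP; exists (fun i => s`_i) => x.
  have [c [sz_c cZ ->]] := span_s x.
  exists (\row_i (in_division_subring (@center_division_subring D)
    (cZ i (ltn_ord i)) : F)).
  by apply: eq_bigr => i _; rewrite mxE.
(* A spanning family of minimal length is free: a relation with nonzero coordinate [j] would allow
   [b j] to be dropped. *)
case: (ex_minnP exn) => n /asboolP[b b_onto] n_min.
have := comb_onto_gt0 b_onto; case: n b b_onto n_min => // n b b_onto n_min _.
exists n, b; split=> // u u0; apply/rowP=> j; rewrite mxE.
apply/eqP/negPn/negP => uj0.
suff /asboolP/n_min : spans n by rewrite ltnn.
exists (fun i => b (lift j i)) => x; have [v ->] := b_onto x.
pose w := v - (v 0 j / u 0 j) *: u.
exists (\row_i w 0 (lift j i)).
have -> : comb iota b v = comb iota b w.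
  by rewrite /w raddfB /= combZ u0 mulr0 subr0.
rewrite /comb (bigD1_ord j) //= {1}/w !mxE divfK // subrr mul0r add0r.
by apply: eq_bigr => i _; rewrite !mxE.
Qed.

(* The span of the basis over the subfield generated by the structure constants and
   by the coordinates of the generators is already a division ring, hence all of D. *)
Lemma center_field_fg n (b : 'I_n.+1 -> D) (S : seq D) :
  (forall u, comb iota b u = 0 -> u = 0) -> (forall x, exists u, x = comb iota b u) ->
  (forall x, gen_division_subring (fun y => y \in S) x) ->
  exists cs : seq F, forall f : F, gen_division_subring (fun y => y \in cs) f.
Proof.
move=> b_free b_onto S_gen; have /choice[coord coordP] := b_onto.
pose X := 1 :: S ++ [seq b p.1 * b p.2 | p <- enum [set: 'I_n.+1 * 'I_n.+1]].
pose cs := [seq coord x 0 k | x <- X, k <- enum 'I_n.+1].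
exists cs => f; set F0 := gen_division_subring _.
have F0_sub : is_division_subring F0 by exact: gen_division_subringP.
have cs_X x k : x \in X -> F0 (coord x 0 k).
  move=> xX; apply: mem_gen_division_subring; apply/allpairsP.
  by exists (x, k); rewrite mem_enum.
pose L := subfield_type F0_sub (@field_division_ring F) (fun x y _ _ => mulrC x y).
pose iota0 : {rmorphism L -> D} := iota \o (val : {rmorphism L -> F}).
have comb0E u : comb iota0 b u = comb iota b (map_mx val u).
  by apply: eq_bigr => i _; rewrite mxE.
have iota0_central l x : iota0 l * x = x * iota0 l by exact: center_field_central.
have b_free0 u : comb iota0 b u = 0 -> u = 0.
  rewrite comb0E => /b_free/rowP u0; apply/rowP=> i; apply: val_inj.
  by have := u0 i; rewrite !mxE => ->; rewrite rmorph0.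
pose V x := exists u, x = comb iota0 b u.
have V_X x : x \in X -> V x.
  move=> xX; exists (\row_k (in_division_subring F0_sub (cs_X x k xX) : L)).
  by rewrite comb0E {1}(coordP x); congr comb; apply/rowP=> k; rewrite !mxE.
have V_mul u : exists A,
    forall v, comb iota0 b u * comb iota0 b v = comb iota0 b (v *m A).
  apply: mul_comb => // j.
  have /choice[w wP] i : exists w, b i * b j = comb iota0 b w.
    apply: V_X; rewrite inE mem_cat; apply/orP; right; apply/orP; right.
    by apply/mapP; exists (i, j); rewrite ?mem_enum ?inE.
  exists (\sum_i u 0 i *: w i); rewrite raddf_sum [comb _ _ u]/comb mulr_suml.
  by apply: eq_bigr => i _; rewrite /= combZ -mulrA wP.
have [e e1] : V 1 by apply: V_X; rewrite mem_head.
have V_sub : is_division_subring V.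
  split.
  - by exists 0; rewrite raddf0.
  - by exists e.
  - by move=> _ _ [u ->] [v ->]; exists (u - v); rewrite raddfB.
  - move=> _ _ [u ->] [v ->]; have [A AP] := V_mul u.
    by exists (v *m A); rewrite AP.
  - move=> x x0 [u xu]; have [A AP] := V_mul u; rewrite -xu in AP.
    have A_unit := mul_comb_unitmx b_free0 D_div x0 AP.
    (* [e] holds the coordinates of [1], so solving [x * y = 1] amounts to inverting the matrix of
       [x]. *)
    exists (e *m invmx A); apply: (mulrI (D_div x0)).
    by rewrite AP mulmxKV // -e1 mulrV ?D_div.
have [u fu] : V (val f).
  apply: S_gen => // y yS; apply: V_X; rewrite inE mem_cat yS orbT //.
have e_neq0 : e != 0.
  by apply: contra_eq_neq e1 => ->; rewrite raddf0 oner_neq0.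
have [k ek] : exists k, e 0 k != 0.
  by case/rV0Pn: e_neq0 => k; exists k.
(* Comparing the coordinates of [f * 1] and of [f] exhibits [f] as a quotient of two elements of
   [F0]. *)
have fe : f *: map_mx val e = map_mx val u :> 'rV[F]_n.+1.
  by apply: (comb_inj b_free); rewrite combZ -!comb0E -e1 mulr1.
have {fe} fe : f * val (e 0 k) = val (u 0 k).
  by have /rowP/(_ k) := fe; rewrite !mxE.
have vek : val (e 0 k) != 0 :> F.
  by apply: contraNneq ek => ek; apply/eqP/val_inj; rewrite rmorph0.
have [_ _ _ F0M F0V] := F0_sub.
rewrite -[f](mulfK vek) fe; apply: F0M; first exact: division_subring_valP.
by apply: F0V => //; exact: division_subring_valP.
Qed.
End CenterField.

(** * Exponent of the torsion elements *)

(** This is a commutative division subring containing [u] and the center, hence a field extension of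
    the center in which [u] is an ordinary root of unity. *)
Definition double_centralizer (D : unitRingType) (u x : D) :=
  forall y, u * y = y * u -> x * y = y * x.

Lemma double_centralizer_division_subring (D : unitRingType) (u : D) :
  is_division_subring (double_centralizer u).
Proof.
split=> [y _|y _|x y xC yC z zC|x y xC yC z zC|x _ xC y yC].
- by rewrite mul0r mulr0.
- by rewrite mul1r mulr1.
- by rewrite mulrBl mulrBr xC ?yC.
- by rewrite -mulrA yC // mulrA xC // mulrA.
- exact/esym/commrV/esym/xC.
Qed.

Lemma double_centralizer_comm (D : unitRingType) (u x y : D) :
  double_centralizer u x -> double_centralizer u y -> x * y = y * x.
Proof. by move=> xC yC; apply/xC/esym/yC. Qed.

Section TorsionExponent.
Variables (D : unitRingType) (D_div : is_division_ring D).
Local Notation F := (center_field D_div).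
Local Notation iota := (val : {rmorphism F -> D}).

Section DoubleCentralizerField.
Variable u : D.

Local Notation E := (subfield_type (double_centralizer_division_subring u) D_div
  (@double_centralizer_comm D u)).

Lemma center_double_centralizer (l : F) : double_centralizer u (val l).
Proof. by move=> y _; exact: center_field_central. Qed.

Definition center_inclusion (l : F) : E :=
  in_division_subring (double_centralizer_division_subring u)
    (center_double_centralizer l).

Fact center_inclusion_is_zmod_morphism : zmod_morphism center_inclusion.
Proof. by move=> x y; apply: val_inj; rewrite rmorphB. Qed.

Fact center_inclusion_is_monoid_morphism : monoid_morphism center_inclusion.
Proof.
by split=> [|x y]; apply: val_inj; rewrite ?rmorph1 ?rmorphM.
Qed.

HB.instance Definition _ := GRing.isZmodMorphism.Build F E center_inclusion
  center_inclusion_is_zmod_morphism.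
HB.instance Definition _ := GRing.isMonoidMorphism.Build F E center_inclusion
  center_inclusion_is_monoid_morphism.

Lemma order_in_extension (p : {poly F}) m :
  (0 < m)%N -> u ^+ m = 1 -> \sum_(i < size p) iota p`_i * u ^+ i = 0 ->
  exists (E' : fieldType) (f : {rmorphism F -> E'}) (z : E') (n : nat),
    [/\ root (map_poly f p) z, n.-primitive_root z & u ^+ n = 1].
Proof.
move=> m0 um pu; have uC : double_centralizer u u by [].
pose z : E := in_division_subring (double_centralizer_division_subring u) uC.
have zm : z ^+ m = 1 by apply: val_inj; rewrite rmorphXn rmorph1.
have [n prim_z _] := prim_order_exists m0 zm.
exists E, center_inclusion, z, n; split=> //.
  apply/rootP/val_inj; rewrite rmorph0 -pu.
  rewrite (@horner_coef_wide _ (size p)) ?size_poly // rmorph_sum.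
  by apply: eq_bigr => i _; rewrite coef_map rmorphM rmorphXn.
by have := congr1 val (prim_expr_order prim_z); rewrite rmorphXn rmorph1.
Qed.
End DoubleCentralizerField.

Lemma torsion_exponent n (b : 'I_n.+1 -> D) (S : seq D) :
  (forall v, comb iota b v = 0 -> v = 0) -> (forall x, exists v, x = comb iota b v) ->
  (forall x, gen_division_subring (fun y => y \in S) x) ->
  exists B, B%:R != 0 :> D /\
    forall (u : D) m, (0 < m)%N -> u ^+ m = 1 -> u ^+ B = 1.
Proof.
move=> b_free b_onto S_gen.
have [cs cs_gen] := center_field_fg b_free b_onto S_gen.
have [B0 B0P] := bounded_roots_of_unity_fg (erefl (size cs)) cs_gen n.+2.
have [rho rhoP] := regular_rep_exists (@center_field_central _ D_div) b_onto.
(* Keeping only factors that are nonzero in [F] makes the product nonzero there. No order is lost,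
   since the order of a primitive root of unity is nonzero in the field. *)
exists (\prod_(i < B0.+1 | i%:R != 0%R :> F) i)%N; split.
  have nz : (\prod_(i < B0.+1 | i%:R != 0%R :> F) i)%N%:R != 0 :> F.
    by rewrite natr_prod; apply/prodf_neq0.
  rewrite -(rmorph_nat iota); apply: contraNneq nz => e.
  by apply/eqP/val_inj; rewrite rmorph0.
move=> u m m0 um; pose p := char_poly (rho u).
have szp : size p = n.+2 by rewrite size_char_poly.
have pu : \sum_(i < size p) iota p`_i * u ^+ i = 0.
  by rewrite szp; exact: regular_rep_char_poly.
have [E [f [z [N [pz prim_z uN]]]]] := order_in_extension m0 um pu.
have p0 : p != 0 by exact/monic_neq0/char_poly_monic.
have le_N : (N <= B0)%N by apply: B0P p0 _ pz prim_z; rewrite szp.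
have N0 : N%:R != 0 :> F.
  by rewrite -(fmorph_eq0 f) rmorph_nat (prim_root_natf_neq0 prim_z).
have N_dvd : (N %| \prod_(i < B0.+1 | i%:R != 0%R :> F) i)%N.
  by rewrite (bigD1 (Ordinal (le_N : N < B0.+1)%N)) //= dvdn_mulr.
by case/dvdnP: N_dvd => q ->; rewrite mulnC exprM uN expr1n.
Qed.
End TorsionExponent.

(** Positions in [s] embed [D] into an ordinal; with the resulting finite structure this is
    Wedderburn's little theorem. *)
Lemma finite_division_ring_comm (D : unitRingType) (s : seq D) :
  is_division_ring D -> (forall x, x \in s) -> forall x y : D, x * y = y * x.
Proof.
move=> D_div s_all.
have domR (x y : D) : x * y = 0 -> (x == 0) || (y == 0).
  move=> xy; have [//|x0] := eqVneq x 0.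
  by rewrite -[y](mulKr (D_div x x0)) xy mulr0 eqxx.
pose f (x : D) : 'I_(size s) := Ordinal (etrans (index_mem x s) (s_all x)).
pose g (i : 'I_(size s)) : D := s`_i.
have fK : cancel f g by move=> x; rewrite /g /f /= nth_index.
pose C : countType := HB.pack D (CanIsCountable fK).
pose R : finUnitRingType :=
  HB.pack D (CanIsCountable fK) (@CanIsFinite C 'I_(size s) f g fK).
exact: (@finDomain_mulrC R domR).
Qed.

(** * Rational functions of a central parameter *)

Section Near0.
Variables (D : unitRingType) (D_div : is_division_ring D).
Local Notation Zp := (division_subring_pred (@center_division_subring D)).

(** A notion of almost all central parameters: it includes [t = 0], is stable under intersection,
    and over an infinite center also provides a nonzero [t]. *)
Definition near0 (P : D -> Prop) := exists R : {poly D}, R.[0] != 0 /\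
  forall t, center t -> R.[t] != 0 -> P t.

Lemma mulr_neq0 (x y : D) : x != 0 -> y != 0 -> x * y != 0.
Proof.
move=> /D_div xU y0; apply: contraNneq y0 => xy.
by rewrite -[y](mulKr xU) xy mulr0.
Qed.

Lemma hornerM_center (p q : {poly D}) t : center t ->
  (p * q).[t] = p.[t] * q.[t].
Proof. by move=> tZ; apply: hornerM_comm; rewrite /comm_poly tZ. Qed.

Lemma center0 : center (0 : D).
Proof. by case: (center_division_subring D). Qed.

Lemma near0W (P Q : D -> Prop) :
  (forall t, center t -> P t -> Q t) -> near0 P -> near0 Q.
Proof. by move=> PQ [R [R0 RP]]; exists R; split=> // t tZ /(RP t tZ); exact: PQ. Qed.

Lemma near0I (P Q : D -> Prop) :
  near0 P -> near0 Q -> near0 (fun t => P t /\ Q t).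
Proof.
move=> [R [R0 RP]] [U [U0 UQ]]; exists (R * U); split.
  by rewrite (hornerM_center _ _ center0) mulr_neq0.
move=> t tZ; rewrite hornerM_center // => RUt.
by split; [apply: RP|apply: UQ] => //; apply: contraNneq RUt => ->;
  rewrite ?mul0r ?mulr0.
Qed.

Lemma near0_forall (P : nat -> D -> Prop) r :
  (forall i, near0 (P i)) -> near0 (fun t => forall i, (i < r)%N -> P i t).
Proof.
move=> nP; elim: r => [|r IHr]; first by exists 1; rewrite hornerC oner_neq0.
apply: near0W (near0I IHr (nP r)) => t _ [Pt Prt] i.
by rewrite ltnS leq_eqVlt => /predU1P[->|/Pt].
Qed.

Lemma near0_at0 P : near0 P -> P 0.
Proof. by move=> [R [R0 RP]]; apply: RP => //; exact: center0. Qed.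

Lemma near0_poly (R : {poly D}) : R.[0] != 0 -> near0 (fun t => R.[t] != 0).
Proof. by move=> R0; exists R. Qed.

Lemma uniq_roots_center (s : seq D) :
  uniq s -> (forall x, x \in s -> center x) -> uniq_roots s.
Proof.
elim: s => //= x s IHs /andP[xs us] sZ; rewrite IHs ?andbT //; last first.
  by move=> y ys; apply: sZ; rewrite inE ys orbT.
apply/allP=> y ys; rewrite /diff_roots (sZ x) ?mem_head // eqxx /=.
by apply: D_div; rewrite subr_eq0; apply: contraNneq xs => <-.
Qed.

Lemma near0_exists P :
  (forall k, exists s : seq D,
     [/\ uniq s, size s = k & forall x, x \in s -> center x]) ->
  near0 P -> exists t, [/\ center t, t != 0 & P t].
Proof.
move=> Z_inf [R [R0 RP]].
have nzR : R != 0 by apply: contraNneq R0 => ->; rewrite horner0.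
(* [R * 'X] has size [(size R).+1], so it cannot vanish at that many distinct central points; the
   factor ['X] forces [t] to be nonzero. *)
have [s [us sz_s sZ]] := Z_inf (size R).+1.
have [/allP s_root|] := boolP (all (root (R * 'X)) s).
  have : (size s < size (R * 'X)%R)%N.
    apply: max_ring_poly_roots (uniq_roots_center us sZ); last exact/allP.
    by rewrite -size_poly_gt0 size_mulX.
  by rewrite size_mulX // sz_s ltnn.
rewrite -has_predC => /hasP[t ts /=]; rewrite rootE hornerMX => Rt0.
exists t; split; first exact: sZ.
  by apply: contraNneq Rt0 => ->; rewrite mulr0.
by apply: RP; [exact: sZ|apply: contraNneq Rt0 => ->; rewrite mul0r].
Qed.

(** The numerator is arbitrary, but the denominator takes central values at central [t], so
    fractions multiply and add as over a commutative ring. *)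
Definition rational_fun (phi : D -> D) := exists P Q : {poly D},
  [/\ Q \is a polyOver Zp, Q.[0] != 0 & near0 (fun t => phi t * Q.[t] = P.[t])].

Lemma center_horner (Q : {poly D}) t : Q \is a polyOver Zp -> center t -> center Q.[t].
Proof.
move=> QZ tZ; apply/(division_subring_predP (center_division_subring D)).
by apply: rpred_horner => //; exact/division_subring_predP.
Qed.

Lemma rational_cst a : rational_fun (fun=> a).
Proof.
exists a%:P, 1; split; [exact: rpred1|by rewrite hornerC oner_neq0|].
by exists 1; split=> [|t _ _]; rewrite !hornerC ?oner_neq0 ?mulr1.
Qed.

Lemma rationalM phi psi : rational_fun phi -> rational_fun psi ->
  rational_fun (fun t => phi t * psi t).
Proof.
move=> [P1 [Q1 [Q1Z Q10 E1]]] [P2 [Q2 [Q2Z Q20 E2]]].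
exists (P1 * P2), (Q1 * Q2); split; first exact: rpredM.
  by rewrite (hornerM_center _ _ center0) mulr_neq0.
apply: near0W (near0I E1 E2) => t tZ [e1 e2].
rewrite !hornerM_center // -e1 -e2 !mulrA; congr (_ * _); rewrite -!mulrA.
by rewrite -(center_horner Q1Z tZ).
Qed.

Lemma rationalD phi psi : rational_fun phi -> rational_fun psi ->
  rational_fun (fun t => phi t + psi t).
Proof.
move=> [P1 [Q1 [Q1Z Q10 E1]]] [P2 [Q2 [Q2Z Q20 E2]]].
exists (P1 * Q2 + P2 * Q1), (Q1 * Q2); split; first exact: rpredM.
  by rewrite (hornerM_center _ _ center0) mulr_neq0.
apply: near0W (near0I E1 E2) => t tZ [e1 e2].
rewrite hornerD !hornerM_center // -e1 -e2 mulrDl !mulrA; congr (_ + _).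
by rewrite -!mulrA (center_horner Q1Z tZ).
Qed.

Lemma rational_geometric phi B : rational_fun phi ->
  rational_fun (fun t => \sum_(j < B) phi t ^+ j).
Proof.
move=> rphi; have rX j : rational_fun (fun t => phi t ^+ j).
  elim: j => [|j IHj]; first exact: rational_cst.
  by under eq_fun do rewrite exprS; exact: rationalM.
elim: B => [|B IHB]; first by under eq_fun do rewrite big_ord0; exact: rational_cst.
by under eq_fun do rewrite big_ord_recr; exact: rationalD.
Qed.

Lemma rational_near0_neq0 phi : rational_fun phi -> phi 0 != 0 ->
  near0 (fun t => phi t != 0).
Proof.
move=> [P [Q [_ Q0 E]]] phi0.
have P0 : P.[0] != 0 by rewrite -(near0_at0 E) mulr_neq0.
apply: near0W (near0I E (near0_poly P0)) => t _ [e Pt].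
by apply: contraNneq Pt => phit; rewrite -e phit mul0r.
Qed.

Lemma rational_affine b : rational_fun (fun t => 1 + t * b).
Proof.
exists (b%:P * 'X + 1), 1; split; [exact: rpred1|by rewrite hornerC oner_neq0|].
exists 1; split=> [|t tZ _]; first by rewrite hornerC oner_neq0.
by rewrite hornerD hornerMX !hornerC mulr1 addrC tZ.
Qed.

(* Homogenizing the equation of [- b] gives [(1 + t b) H(t) = Q(t)] with Q central. *)
Lemma rational_affine_inv b m (c : nat -> D) :
  (forall i, center (c i)) -> c m != 0 -> \sum_(i < m.+1) c i * (- b) ^+ i = 0 ->
  rational_fun (fun t => (1 + t * b)^-1).
Proof.
move=> cZ cm0 cb.
(* With [x = - t b], the sum of [c i * t ^+ (m - i) * x ^+ i] is [t ^+ m] times the given relation,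
   hence zero. So [Q(t)] is also the sum of [c i * t ^+ (m - i) * (1 - x ^+ i)], and [H] collects
   the quotients by [1 - x]. *)
pose Q := \sum_(i < m.+1) (c i)%:P * 'X^(m - i).
pose H := \sum_(i < m.+1) \sum_(j < i) (c i * (- b) ^+ j)%:P * 'X^(m - i + j).
have QE t : Q.[t] = \sum_(i < m.+1) c i * t ^+ (m - i).
  by rewrite horner_sum; apply: eq_bigr => i _; rewrite hornerCM hornerXn.
have Q0 : Q.[0] != 0.
  (* At [0] only the term [i = m] survives, with value [c m]. *)
  rewrite QE big_ord_recr /= subnn expr0 mulr1 big1 ?add0r // => i _.
  by rewrite expr0n subn_eq0 leqNgt ltn_ord mulr0.
have HQ t : center t -> (1 + t * b) * H.[t] = Q.[t].
  move=> tZ; have tX j y : t ^+ j * y = y * t ^+ j.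
    exact: esym (commrX j (esym (tZ y))).
  pose x := t * - b.
  have -> : H.[t] = \sum_(i < m.+1) c i * t ^+ (m - i) * \sum_(j < i) x ^+ j.
    rewrite horner_sum; apply: eq_bigr => i _; rewrite horner_sum mulr_sumr.
    apply: eq_bigr => j _; rewrite hornerCM hornerXn exprD /x.
    rewrite exprMn_comm; last exact: tZ.
    by rewrite -!mulrA; congr (_ * _); rewrite -exprD -tX exprD -mulrA.
  have -> : 1 + t * b = 1 - x by rewrite /x mulrN opprK.
  have xX i : (1 - x) * (\sum_(j < i) x ^+ j) = 1 - x ^+ i.
    by rewrite -[1 - x]opprB mulNr -subrX1 opprB.
  transitivity (\sum_(i < m.+1) c i * t ^+ (m - i) * (1 - x ^+ i)).
    rewrite mulr_sumr; apply: eq_bigr => i _; rewrite -xX !mulrA; congr (_ * _).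
    by rewrite -(cZ i) -!mulrA tX.
  rewrite QE; apply/eqP; rewrite -subr_eq0 -sumrB.
  rewrite (eq_bigr (fun i : 'I__ => - (t ^+ m * (c i * (- b) ^+ i)))); last first.
    move=> i _; rewrite mulrBr mulr1 addrAC subrr add0r; congr (- _).
    rewrite /x exprMn_comm; last exact: tZ.
    rewrite -mulrA [t ^+ (m - i) * _]mulrA -exprD (subnK (leq_ord i)).
    by rewrite !mulrA tX.
  by rewrite sumrN -mulr_sumr cb mulr0 oppr0.
exists H, Q; split=> //.
  apply: rpred_sum => i _; apply: rpredM; last exact/rpredX/polyOverX.
  by rewrite polyOverC; exact/division_subring_predP.
apply: near0W (near0_poly Q0) => t tZ Qt.
have nz : 1 + t * b != 0.
  by apply: contraNneq Qt => e; rewrite -HQ // e mul0r.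
by rewrite -HQ // mulKr ?D_div.
Qed.
End Near0.

(** * Iterated commutators *)

Section IteratedCommutators.
Variables (D : unitRingType) (D_div : is_division_ring D).

Definition iter_comm (a : D) r x := iter r (fun y => a * y * a^-1 * y^-1) x.

Lemma iter_commS a r x : iter_comm a r.+1 x =
  a * iter_comm a r x * a^-1 * (iter_comm a r x)^-1.
Proof. by []. Qed.

Lemma invr_neq0_div (x : D) : x != 0 -> x^-1 != 0.
Proof. by move=> x0; apply: contraNneq x0 => x'0; rewrite -[x]invrK x'0 invr0. Qed.

Lemma comm_neq0 (a x : D) : a != 0 -> x != 0 -> a * x * a^-1 * x^-1 != 0.
Proof. by move=> a0 x0; rewrite !(mulr_neq0, invr_neq0_div). Qed.

Lemma iter_comm_neq0 (a : D) r x : a != 0 -> x != 0 -> iter_comm a r x != 0.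
Proof. by move=> a0 x0; elim: r => // r IHr; rewrite iter_commS comm_neq0. Qed.

Lemma iter_comm1 (a : D) r : a != 0 -> iter_comm a r 1 = 1.
Proof.
move=> a0; elim: r => // r IHr.
by rewrite iter_commS IHr mulr1 invr1 mulr1 mulrV ?D_div.
Qed.

Lemma invr_comm (a y : D) : a != 0 ->
  (a * y * a^-1 * y^-1)^-1 = y * a * y^-1 * a^-1.
Proof.
(* The case [y = 0] rests on the convention that [0] is its own inverse; it allows rewriting an
   equality of functions at every [t]. *)
move=> a0; have [->|y0] := eqVneq y 0; first by rewrite !(mulr0, mul0r, invr0).
have [aU yU] := (D_div a0, D_div y0).
by rewrite !invrM ?unitrMl ?unitrV // !invrK !mulrA.
Qed.

(** The inverse of a commutator is again a product of constants, the inner function and its inverse,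
    so both are carried through the induction. *)
Lemma rational_iter_comm a x r : a != 0 ->
  rational_fun x -> rational_fun (fun t => (x t)^-1) ->
  rational_fun (fun t => iter_comm a r (x t)).
Proof.
move=> a0 rx rx'.
suff [] : rational_fun (fun t => iter_comm a r (x t)) /\
          rational_fun (fun t => (iter_comm a r (x t))^-1) by [].
have cst y : rational_fun (fun=> y) := rational_cst y.
elim: r => [|r [IHr IHr']]; first by [].
split.
  do 3![apply: rationalM => //].
rewrite (_ : (fun t => _) = fun t => iter_comm a r (x t) * a *
  (iter_comm a r (x t))^-1 * a^-1).
  do 3![apply: rationalM => //].
by apply/funext => t; rewrite iter_commS invr_comm.
Qed.

Lemma geometric_eq1 (y : D) B :
  y ^+ B = 1 -> \sum_(j < B) y ^+ j != 0 -> y = 1.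
Proof.
move=> yB g0; apply/eqP; rewrite -subr_eq0; apply/negPn/negP => y1.
by have := mulr_neq0 D_div y1 g0; rewrite -subrX1 yB subrr eqxx.
Qed.

Lemma comm_eq1 (a y : D) : a != 0 -> y != 0 ->
  a * y * a^-1 * y^-1 = 1 -> a * y = y * a.
Proof.
move=> a0 y0 e; have aU := D_div a0; have yU := D_div y0.
by rewrite -[LHS](mulrVK aU) -[a * y * a^-1](mulrVK yU) e mul1r.
Qed.

(* If [u := [a, y]] commutes with [a], then [a ^+ k * y = u ^+ k * y * a ^+ k]. *)
Lemma comm_torsion (a y : D) k : a != 0 -> y != 0 -> center (a ^+ k) ->
  let u := a * y * a^-1 * y^-1 in a * u = u * a -> u ^+ k = 1.
Proof.
move=> a0 y0 akZ u au; have aU := D_div a0; have yU := D_div y0.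
have ay : a * y = u * y * a by rewrite /u !mulrVK.
have akE j : a ^+ j * y = u ^+ j * y * a ^+ j.
  elim: j => [|j IHj]; first by rewrite !expr0 mul1r mulr1.
  rewrite exprS -mulrA IHj !mulrA [a * _](commrX j au) -(mulrA _ a y) ay.
  by rewrite exprSr !mulrA.
have := akE k; rewrite akZ => e.
have akU : a ^+ k \is a GRing.unit by rewrite unitrX.
by apply: (mulIr yU); apply: (mulIr akU); rewrite mul1r -e.
Qed.

Lemma iter_comm_descent (a x : D) r k m B :
  a != 0 -> x != 0 -> (0 < k)%N -> center (a ^+ k) ->
  (forall (u : D) m, (0 < m)%N -> u ^+ m = 1 -> u ^+ B = 1) ->
  (forall i, (i < r.+1)%N -> \sum_(j < B) iter_comm a i.+1 x ^+ j != 0) ->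
  (0 < m)%N -> iter_comm a r.+1 x ^+ m = 1 -> a * x = x * a.
Proof.
move=> a0 x0 k0 akZ BP; elim: r m => [|r IHr] m geo m0 um.
all: have u1 := geometric_eq1 (BP _ _ m0 um) (geo _ (ltnSn _)).
  exact: comm_eq1 u1.
apply: (IHr k) => // [i lt_ir|].
  by apply: geo; rewrite ltnS ltnW.
apply: (@comm_torsion a (iter_comm a r x) k a0 (iter_comm_neq0 r a0 x0) akZ).
exact: (@comm_eq1 a (iter_comm a r.+1 x) a0 (iter_comm_neq0 _ a0 x0) u1).
Qed.
End IteratedCommutators.

(** * Radical iterated commutators in a finite-dimensional division ring *)

Section RadicalCommutators.
Variables (D : unitRingType) (D_div : is_division_ring D).
Local Notation F := (center_field D_div).
Local Notation iota := (val : {rmorphism F -> D}).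

Lemma infinite_center :
  ~ (exists s : seq F, forall x, x \in s) ->
  forall k, exists s : seq D,
    [/\ uniq s, size s = k & forall x, x \in s -> center x].
Proof.
move=> F_inf k.
have [s [us <-]] : exists s : seq F, uniq s /\ size s = k.
  elim: k => [|k [s [us sz_s]]]; first by exists [::].
  have [x xs] : exists x, x \notin s.
    apply/not_existsP => s_all; apply: F_inf; exists s => x.
    by have /negP/negPn := s_all x.
  by exists (x :: s); rewrite /= xs us sz_s.
exists (map val s); rewrite map_inj_uniq ?size_map //; last exact: val_inj.
by split=> // _ /mapP[x _ ->]; exact: (division_subring_valP x).
Qed.

Lemma finite_center_comm n (b : 'I_n -> D) (s : seq F) :
  (forall x, exists u, x = comb iota b u) -> (forall x, x \in s) ->
  forall x y : D, x * y = y * x.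
Proof.
move=> b_onto s_all.
pose rows := [seq comb iota b (\row_i val (g i)) | g : {ffun 'I_n -> seq_sub s}].
apply: (@finite_division_ring_comm D rows) => // x; have [u ->] := b_onto x.
apply/mapP; exists [ffun i => SeqSub (s_all (u 0 i))]; first by rewrite mem_enum.
by congr comb; apply/rowP=> i; rewrite mxE ffunE.
Qed.

Lemma radical_iter_comm_center n (b : 'I_n.+1 -> D) (S : seq D) (a : D) k r :
  (forall v, comb iota b v = 0 -> v = 0) -> (forall x, exists v, x = comb iota b v) ->
  (forall x, gen_division_subring (fun y => y \in S) x) ->
  a != 0 -> (0 < k)%N -> center (a ^+ k) ->
  (forall x, x != 0 -> exists m, (0 < m)%N /\ center (iter_comm a r.+1 x ^+ m)) ->
  center a.
Proof.
move=> b_free b_onto S_gen a0 k0 akZ rad y.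
have [[s s_all]|F_inf] := pselect (exists s : seq F, forall x, x \in s).
  exact: finite_center_comm b_onto s_all _ _.
have [B [B0 BP]] := torsion_exponent b_free b_onto S_gen.
have iotaC := @center_field_central _ D_div.
have [rho rhoP] := regular_rep_exists iotaC b_onto.
pose x t := 1 + t * y.
have rx : rational_fun x := rational_affine y.
have rx' : rational_fun (fun t => (x t)^-1).
  pose p := char_poly (rho (- y)).
  apply: (rational_affine_inv D_div (m := n.+1) (c := fun i => iota p`_i)).
  - by move=> i; exact: (division_subring_valP p`_i).
  - have -> : p`_n.+1 = lead_coef p by rewrite lead_coefE size_char_poly.
    by rewrite (monicP (char_poly_monic _)) rmorph1 oner_neq0.
  - exact: regular_rep_char_poly.
have x00 : x 0 = 1 by rewrite /x mul0r addr0.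
have near_geo : near0 (fun t => forall i, (i < r.+1)%N ->
    \sum_(j < B) iter_comm a i.+1 (x t) ^+ j != 0).
  apply: near0_forall => // i; apply: rational_near0_neq0 => //.
    exact/rational_geometric/rational_iter_comm.
  (* At [t = 0] the commutators equal [1], so each sum is [B%:R], which is nonzero by the choice of
     [B]. *)
  rewrite x00 iter_comm1 //; under eq_bigr do rewrite expr1n.
  by rewrite sumr_const card_ord.
have near_x : near0 (fun t => x t != 0).
  by apply: rational_near0_neq0 => //; rewrite x00 oner_neq0.
have [t [tZ t0 [geo xt0]]] :=
  near0_exists D_div (infinite_center F_inf) (near0I D_div near_geo near_x).
have [m [m0 wZ]] := rad _ xt0.
pose z : F := in_division_subring (@center_division_subring D) wZ.
have w_tors : iter_comm a r.+1 (x t) ^+ (m * n.+1) = 1.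
  apply: (radical_comm_torsion D_div b_free rhoP (z := z) a0) => //.
  exact: iter_comm_neq0.
have mn0 : (0 < m * n.+1)%N by rewrite muln_gt0 m0.
have := iter_comm_descent D_div a0 xt0 k0 akZ BP geo mn0 w_tors.
(* Since [a] commutes with [1 + t * y], cancelling [1] and the nonzero central [t] leaves [y]. *)
rewrite /x mulrDl mulrDr mulr1 mul1r => /addrI.
by rewrite mulrA -(tZ a) -!mulrA => /(mulrI (D_div t0)).
Qed.
End RadicalCommutators.

(** * From a subnormal subgroup to the division subring generated by two elements *)

(** Each subnormal step costs one commutator: for [a] in [N] and [y] in [M], [[a, y]] is [a] times a
    conjugate of its inverse by [y], hence in [N]. *)
Lemma subnormal_iter_comm (D : unitRingType) (N : D -> Prop) :
  is_division_ring D -> subnormal N ->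
  exists r, forall a x, N a -> x != 0 -> N (iter_comm a r x).
Proof.
move=> D_div; elim=> {N} [|N M _ [r Mr] [[_ N1 NM NV] [_ _ _ MV] NM_sub NJ]].
  by exists 0%N => a x _.
exists r.+1 => a x Na x0; rewrite iter_commS -!mulrA; apply: NM => //.
set y := iter_comm a r x.
have My : M y by apply: Mr => //; exact: NM_sub.
by have := NJ _ _ (NV _ Na) (MV _ My); rewrite invrK -!mulrA.
Qed.

Lemma val_division_subring_inv (D : unitRingType) (T : D -> Prop)
    (T_sub : is_division_subring T) (x : division_subring_type T_sub) :
  is_division_ring D -> val x^-1 = (val x)^-1.
Proof.
move=> D_div; have [->|x0] := eqVneq x 0; first by rewrite !(invr0, rmorph0).
by rewrite rmorphV //; exact: (@division_subring_div _ _ T_sub D_div).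
Qed.

Lemma val_iter_comm (D : unitRingType) (T : D -> Prop)
    (T_sub : is_division_subring T) (a x : division_subring_type T_sub) r :
  is_division_ring D -> val (iter_comm a r x) = iter_comm (val a) r (val x).
Proof.
move=> D_div; elim: r => // r IHr; rewrite !iter_commS -IHr.
by rewrite -!val_division_subring_inv // -!rmorphM.
Qed.

Lemma fin_dim_division_subring_basis (D : unitRingType) (T : D -> Prop)
    (T_sub : is_division_subring T) :
  fin_dim_over_center T ->
  exists s : seq (division_subring_type T_sub), forall x,
    exists c : seq (division_subring_type T_sub), [/\ size c = size s,
     (forall i, (i < size s)%N -> center c`_i) &
     x = \sum_(i < size s) c`_i * s`_i].
Proof.
move=> [s [sT span_s]].
have [s' es'] : exists s' : seq (division_subring_type T_sub), map val s' = s.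
  by apply: division_subring_lift => x /(nthP 0)[i lt_i <-]; exact: sT.
have sz_s : size s' = size s by rewrite -es' size_map.
exists s' => x; have [c [sz_c [cZ xE]]] := span_s _ (division_subring_valP x).
have [c' ec'] : exists c' : seq (division_subring_type T_sub), map val c' = c.
  apply: division_subring_lift => y /(nthP 0)[i lt_i <-].
  by rewrite sz_c in lt_i; case: (cZ i lt_i).
have sz_c' : size c' = size s' by rewrite -(size_map val) ec' sz_c.
exists c'; split=> // [i lt_i y|].
  have [] := cZ i; first by rewrite -sz_s.
  move=> _ /(_ _ (division_subring_valP y)).
  rewrite -ec' (nth_map 0) ?sz_c' // => e.
  by apply: val_inj; rewrite !rmorphM.
apply: val_inj; rewrite xE rmorph_sum -sz_s; apply: eq_bigr => i _.
by rewrite rmorphM -ec' -es' !(nth_map 0) ?sz_c'.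
Qed.

Theorem theorem6p4 (D : unitRingType) (N : D -> Prop) :
  is_division_ring D -> weakly_locally_finite D ->
  subnormal N -> radical_over N (@center D) ->
  forall x, N x -> center x.
Proof.
move=> D_div wlf N_sub N_rad a Na b.
have [N_neq0 N1 NM NV] : is_subgroup N.
  case: N_sub => [|{}N M _ [] //]; split=> //.
  - exact: oner_neq0.
  - by move=> x y; exact: mulr_neq0.
  - by move=> x; exact: invr_neq0_div.
have [r N_comm] := subnormal_iter_comm D_div N_sub.
have a0 := N_neq0 _ Na.
pose K_sub := gen_division_subringP (fun x : D => x \in [:: a; b]).
pose K := division_subring_type K_sub.
have K_div : is_division_ring K := @division_subring_div _ _ K_sub D_div.
have [S eS] : exists S : seq K, map val S = [:: a; b].
  apply: division_subring_lift => x.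
  exact: (@mem_gen_division_subring D (fun y => y \in _)).
have S_gen y : gen_division_subring (fun z => z \in S) y.
  by apply: gen_division_subring_lift => // x; rewrite eS.
have [s span_s] := fin_dim_division_subring_basis K_sub (wlf [:: a; b]).
have [n [e [e_free e_onto]]] := center_basis_exists K_div span_s.
have [a' ea] : exists a' : K, val a' = a.
  have /mapP[a' _ ea] : a \in map val S by rewrite eS mem_head.
  by exists a'.
have [b' eb] : exists b' : K, val b' = b.
  have /mapP[b' _ eb] : b \in map val S by rewrite eS !inE eqxx orbT.
  by exists b'.
have val_center (x : K) : center (val x) -> center x.
  by move=> xZ y; apply: val_inj; rewrite !rmorphM /= xZ.
have val_neq0 (x : K) : x != 0 -> val x != 0.
  by apply: contraNneq => x0; apply/eqP/val_inj; rewrite rmorph0.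
have [k [k0 akZ]] := N_rad a Na.
suff a'Z : center a' by have := congr1 val (a'Z b'); rewrite !rmorphM /= ea eb.
apply: (radical_iter_comm_center (r := r) e_free e_onto S_gen (k := k)) => //.
- by apply: contraNneq a0 => a'0; rewrite -ea a'0 rmorph0.
- by apply: val_center; rewrite rmorphXn /= ea.
(* One commutator beyond the depth [r] stays in the subgroup [N] and guarantees norm 1 even when
   [r = 0]. *)
move=> x x0; have Nw : N (iter_comm a r.+1 (val x)).
  have Ny := N_comm a (val x) Na (val_neq0 x x0).
  exact: (NM _ _ (NM _ _ (NM _ _ Na Ny) (NV _ Na)) (NV _ Ny)).
have [m [m0 wZ]] := N_rad _ Nw; exists m; split=> //.
have := val_iter_comm a' x r.+1 D_div; rewrite ea => ew; rewrite -ew in wZ.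
by apply: val_center; rewrite rmorphXn; exact: wZ.
Qed.
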